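(* Let $n\geq 2$ and let $\mathbb{P}^n$ be the projective space over an algebraically closed field $\mathbb{K}$. Suppose there is an elementary pyramid $\Delta$ in $\mathbb{P}^n$ and two rational normal curves $C_1, C_2$ in $\mathbb{P}^n$, the former circumscribed about $\Delta$, the latter inscribed in $\Delta$, which are conjugate with respect to $\Delta$. Then there are infinitely many elementary pyramids inscribed in $C_1$ and circumscribed about $C_2$. More precisely, each point of $C_1$ is the vertex of a unique elementary pyramid inscribed in $C_1$ and circumscribed about $C_2$, and each point of $C_2$ is the contact point with $C_2$ of a face of a unique elementary pyramid inscribed in $C_1$ and circumscribed about $C_2$.
   Context: An elementary pyramid $\Delta$ in $\mathbb{P}^n$ is the datum of $n+1$ independent points of $\mathbb{P}^n$ (i.e. points spanning $\mathbb{P}^n$), called its vertices. The faces of $\Delta$ are the $n+1$ hyperplanes spanned by all vertices but one; the face spanned by all vertices except $v$ is called opposite to $v$. An elementary pyramid is uniquely determined by its vertices, as well as by its faces. Let $C$ be a rational normal curve in $\mathbb{P}^n$. (i) $C$ is circumscribed about $\Delta$ (equivalently, $\Delta$ is inscribed in $C$) if $C$ contains all the vertices of $\Delta$. (ii) $C$ is inscribed in $\Delta$ (equivalently, $\Delta$ is circumscribed about $C$) if each face of $\Delta$ hyperosculates $C$ at one point, i.e. it has intersection multiplicity $n$ with $C$ at a point of the face; this point is called the contact point of $C$ with the face. If $C_1$ is a rational normal curve circumscribed about $\Delta$ and $C_2$ is a rational normal curve inscribed in $\Delta$, then $C_1$ and $C_2$ are conjugate with respect to $\Delta$ if there is a projectivity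 (isomorphism) from $C_1\simeq\mathbb{P}^1$ to $C_2\simeq\mathbb{P}^1$ which maps each of the $n+1$ vertices of $\Delta$ on $C_1$ to the contact point of $C_2$ with the opposite face of $\Delta$.
   Formalization: Existence of the pyramid is stated for all but finitely many points of C_1 and of C_2 rather than for each point, since it fails at some points (for n=2, at common points of the two conics); uniqueness is stated for every point. *)

(* Defs.v *)
From HB Require Import structures.
From mathcomp Require Export all_boot all_order all_algebra finmap.
From mathcomp Require Export boolp classical_sets cardinality.
Set Implicit Arguments.
Unset Strict Implicit.
Unset Printing Implicit Defensive.
Import GRing.Theory.

Local Open Scope ring_scope.
Local Open Scope fset_scope.

(* A linear subspace of P^n over K is represented by the corresponding vector
   subspace of K^(n+1): points are the subspaces of dimension 1, hyperplanes
   those of dimension n. *)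
Notation subsp K n := {vspace 'rV[K]_n.+1}.

Section Pyramids.
Variables (K : closedFieldType) (n : nat).
Implicit Types (D : {fset subsp K n}) (p q H : subsp K n).

(* A pyramid is identified with its (unordered) set of vertices. *)
Definition pyramid D : Prop :=
  [/\ #|` D| = n.+1,
      forall p, p \in D -> (\dim p = 1)%N
    & (\sum_(p <- D) p)%VS = fullv].

Definition face D p : subsp K n := (\sum_(q <- D `\ p) q)%VS.

End Pyramids.

(* (s : t) |-> (s^n : s^(n-1) t : ... : t^n); the ring is arbitrary so that it
   can also be evaluated at a vector of polynomials in a local parameter. *)
Definition veronese (R : nzRingType) (n : nat) (u : 'rV[R]_2) : 'rV[R]_n.+1 :=
  \row_(i < n.+1) (u 0 0 ^+ (n - i) * u 0 1 ^+ i).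

(* A rational normal curve of P^n is the image of the n-th Veronese embedding
   of P^1 under a projectivity of P^n. It is given here with the resulting
   parametrization P^1 -> C, which is an isomorphism. *)
Record rnc (K : closedFieldType) (n : nat) :=
  RNC { rnc_mx : 'M[K]_n.+1; rnc_unit : rnc_mx \in unitmx }.

Section Curves.
Variables (K : closedFieldType) (n : nat).
Implicit Types (C : rnc K n) (D : {fset subsp K n}) (p q H : subsp K n).
Implicit Types (u : 'rV[K]_2) (a : 'cV[K]_n.+1).

Definition rnc_point C u : subsp K n := <[veronese n u *m rnc_mx C]>%VS.

Definition rnc_points C : set (subsp K n) :=
  [set p | exists2 u, u != 0 & p = rnc_point C u]%classic.

Definition is_equation H a : Prop :=
  forall v : 'rV[K]_n.+1, (v \in H) = (v *m a == 0).

(* The point u + z w of P^1, with z the indeterminate and w a coordinate vector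
   independent of u: z is a local parameter of P^1 at u (for u != 0). *)
Definition local_param u : 'rV[{poly K}]_2 :=
  map_mx polyC u + 'X *: delta_mx 0 (if u 0 0 == 0 then 0 else 1).

(* Order of vanishing of the linear form a along C at the point with
   parameter u. *)
Definition vanishing_order C a u : nat :=
  mup 0 ((veronese n (local_param u) *m map_mx polyC (rnc_mx C *m a)) 0 0).

Definition has_int_mult C H q (m : nat) : Prop :=
  exists u a, [/\ u != 0, q = rnc_point C u, is_equation H a
                & vanishing_order C a u = m].

(* H hyperosculates C at q, i.e. q is the contact point of C with H. *)
Definition contact C H q : Prop := has_int_mult C H q n.

Definition inscribed D C : Prop := forall p, p \in D -> rnc_points C p.

Definition circumscribed D C : Prop :=
  forall p, p \in D -> exists q, contact C (face D p) q.

(* f is only meaningful on the points of C1. *)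
Definition projectivity C1 C2 (f : subsp K n -> subsp K n) : Prop :=
  exists2 A : 'M[K]_2, A \in unitmx &
    forall u, u != 0 -> f (rnc_point C1 u) = rnc_point C2 (u *m A).

Definition conjugate D C1 C2 : Prop :=
  exists2 f, projectivity C1 C2 f &
    forall p, p \in D -> contact C2 (face D p) (f p).

Definition poncelet_pyramid C1 C2 D : Prop :=
  [/\ pyramid D, inscribed D C1 & circumscribed D C2].

Definition contact_of_face C D q : Prop :=
  exists2 p, p \in D & contact C (face D p) q.

End Curves.

(* Main.v *)
Require Import Defs.
From mathcomp Require Import ring.

(** Why the theorem holds.

    Write nu for the Veronese map, so that C1 is the image of x |-> nu(x) M1
    and C2 that of y |-> nu(y) M2, and let A be the matrix of the projectivity
    of the conjugacy, so that the parameter x of C1 corresponds to the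
    parameter x A of C2. A hyperplane has contact of order n with C2 at the
    parameter u exactly when its equation restricts to C2 as the n-th power of
    the linear form vanishing at u ([contactP]). Hence there is one such
    hyperplane for each u, and the condition E(x, y) = 0 that the point of C1
    with parameter x lies on the hyperplane hyperosculating C2 at y A is given
    by a polynomial E of bidegree (n, n) ([incidence]). A pyramid inscribed in
    C1 and circumscribed about C2, with vertices s_i and contacts t_i A, is the
    same thing as two families of n + 1 points with E(s_i, t_j) = 0 if and only
    if i and j differ ([incidence_dual], [family_pyramid]).

    For the given conjugate pyramid one has t_i = s_i. Lagrange interpolation
    at the s_i then writes E(x, y) as the sum of c_i L_i(x) L_i(y), where L_i is
    the product of the brackets [s_j, x] for j other than i. Multiplying by
    [x, y] and decomposing into partial fractions gives
      [x, y] E(x, y) = P(x) Q(y) - P(y) Q(x)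
    for two forms P and Q of degree n + 1 ([pencil_of_selfpolar]). So
    [x, y] E(x, y) = 0 is the equivalence relation whose classes are the fibres
    of the map (P : Q), of degree n + 1, from the projective line to itself.
    The fibres made of n + 1 distinct points give pyramids of the required kind.

    Conversely every such pyramid, conjugate or not, arises from a fibre: for
    n >= 2 any two vertices s_i and s_j lie in the same fibre as a third contact
    t_k, so that all the vertices are in one fibre, and counting zeros of
    E(s_i, .) forces t_j = s_j ([incident_pairs_selfpolar]). A fibre is
    determined by any of its points, whence the uniqueness for a vertex as well
    as for a contact point.

    A point x lies in a fibre with a repeated point z only if E(z, z) = 0; this
    binary form of degree 2 n is not zero, since it does not vanish at the
    vertices of the given pyramid, and each of its finitely many zeros z has
    finitely many points in its fibre ([pencil_generic_fibre]). So all but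
    finitely many points of either curve belong to a pyramid, and as the curves
    are infinite there are infinitely many pyramids.

    In positive characteristic the hyperosculating hyperplanes of C2 may all
    pass through a common point, as some binomial coefficients vanish. This is
    excluded by the given pyramid, whose faces have no common point; in the
    proof it shows in the interpolation formula, all of whose c_i are nonzero,
    so that E is nondegenerate. *)

Set Implicit Arguments.
Unset Strict Implicit.
Unset Printing Implicit Defensive.
Import GRing.Theory.
Local Open Scope classical_set_scope.
Local Open Scope fset_scope.
Local Open Scope ring_scope.

(** * The bracket on the projective line *)

(** The determinant of two coordinate vectors of the projective line: two
    nonzero vectors represent the same point exactly when it is zero. *)
Definition br (K : fieldType) (x y : 'rV[K]_2) : K :=
  x 0 0 * y 0 1 - x 0 1 * y 0 0.

Section Bracket.
Variable K : fieldType.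
Implicit Types (x y z t u w : 'rV[K]_2).

Lemma rV2_eq x y : x 0 0 = y 0 0 -> x 0 1 = y 0 1 -> x = y.
Proof.
move=> h0 h1; apply/rowP => i.
have [->|->] : i = 0 \/ i = 1.
  by case: i => [[|[|//]] hi]; [left|right]; apply/val_inj.
- exact: h0.
- exact: h1.
Qed.

Lemma brC x y : br y x = - br x y.
Proof. by rewrite /br; ring. Qed.

Lemma br_eq0C x y : (br y x == 0) = (br x y == 0).
Proof. by rewrite brC oppr_eq0. Qed.

Lemma brxx x : br x x = 0.
Proof. by rewrite /br; ring. Qed.

Lemma brZr a x y : br x (a *: y) = a * br x y.
Proof. by rewrite /br !mxE; ring. Qed.

Lemma brDr x y z : br x (y + z) = br x y + br x z.
Proof. by rewrite /br !mxE; ring. Qed.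

Lemma br_plucker x y z t :
  br x y * br z t = br x z * br y t - br x t * br y z.
Proof. by rewrite /br; ring. Qed.

(** A symplectic partner of x. It serves to expand every vector by [br_cramer],
    and later to absorb denominators in the partial fraction decomposition. *)
Lemma exists_br1 x : x != 0 -> exists y, br x y = 1.
Proof.
move=> x0; have [h|h] := eqVneq (x 0 0) 0.
- have h1 : x 0 1 != 0.
    by apply: contra_neq x0 => h1; apply: rV2_eq; rewrite mxE.
  exists (- (x 0 1)^-1 *: delta_mx 0 0); rewrite /br !mxE /= h; field.
  exact: h1.
- by exists ((x 0 0)^-1 *: delta_mx 0 1); rewrite /br !mxE /=; field.
Qed.

Lemma br_cramer x y z : br x y *: z = br z y *: x + br x z *: y.
Proof. by apply: rV2_eq; rewrite /br !mxE; ring. Qed.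

Lemma br_colinear x y : x != 0 -> y != 0 -> br x y = 0 ->
  exists2 a, a != 0 & y = a *: x.
Proof.
move=> x0 y0 h; have [w hw] := exists_br1 x0.
have e : y = br y w *: x.
  by have := br_cramer x w y; rewrite hw scale1r h scale0r addr0.
exists (br y w) => //.
by apply: contra_neq y0 => h0; rewrite e h0 scale0r.
Qed.

Lemma br_trans x y z : y != 0 -> br x y = 0 -> br y z = 0 -> br x z = 0.
Proof.
move=> y0 h1 h2; have [w hw] := exists_br1 y0.
have := br_plucker x z y w; rewrite hw mulr1 h1 (brC y z) h2 oppr0.
by rewrite mul0r mulr0 subrr.
Qed.

Lemma mulmx_neq0 (A : 'M[K]_2) x : A \in unitmx -> x != 0 -> x *m A != 0.
Proof.
move=> uA; apply: contra_neq => h.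
by rewrite -[x](mulmxK uA) h mul0mx.
Qed.

Lemma br_mulmx_eq0 (A : 'M[K]_2) x y : A \in unitmx ->
  (br (x *m A) (y *m A) == 0) = (br x y == 0).
Proof.
have imp (B : 'M[K]_2) u v : B \in unitmx ->
    br u v = 0 -> br (u *m B) (v *m B) = 0.
  move=> uB h; have [->|u0] := eqVneq u 0.
    by rewrite mul0mx /br !mxE !mul0r subrr.
  have [->|v0] := eqVneq v 0.
    by rewrite mul0mx /br !mxE !mulr0 subrr.
  have [a _ ->] := br_colinear u0 v0 h.
  by rewrite -scalemxAl brZr brxx mulr0.
move=> uA; apply/eqP/eqP => h; last exact: imp.
by rewrite -(mulmxK uA x) -(mulmxK uA y) imp // unitmx_inv.
Qed.

End Bracket.

(** * Binary forms *)

(** Binary forms are handled as functions on K^2, because the incidence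
    relation is evaluated at points; the coefficients are extended to all of nat
    so that no casts between index types of different degrees occur. *)
Definition form (K : closedFieldType) (m : nat) (f : 'rV[K]_2 -> K) : Prop :=
  exists c : nat -> K, forall x,
    f x = \sum_(i < m.+1) c i * (x 0 0 ^+ (m - i) * x 0 1 ^+ i).

Section Forms.
Variable K : closedFieldType.
Implicit Types (x y z t u w : 'rV[K]_2) (f g h : 'rV[K]_2 -> K) (m : nat).

Lemma form_ext m f g : f =1 g -> form m f -> form m g.
Proof. by move=> e [c hc]; exists c => x; rewrite -e. Qed.

Lemma formD m f g : form m f -> form m g -> form m (fun x => f x + g x).
Proof.
move=> [c hc] [d hd]; exists (fun i => c i + d i) => x.
by rewrite hc hd -big_split /=; apply: eq_bigr => i _; rewrite mulrDl.
Qed.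

Lemma formZ m a f : form m f -> form m (fun x => a * f x).
Proof.
move=> [c hc]; exists (fun i => a * c i) => x.
by rewrite hc mulr_sumr; apply: eq_bigr => i _; rewrite -mulrA.
Qed.

Lemma form_zero m : form m (fun _ : 'rV[K]_2 => 0).
Proof.
by exists (fun=> 0) => x; rewrite big1 // => i _; rewrite mul0r.
Qed.

Lemma form_const a : form 0 (fun _ : 'rV[K]_2 => a).
Proof. by exists (fun=> a) => x; rewrite big_ord1 !expr0 !mulr1. Qed.

Lemma form_sum m (I : Type) (r : seq I) (F : I -> 'rV[K]_2 -> K) :
  (forall i, form m (F i)) -> form m (fun x => \sum_(i <- r) F i x).
Proof.
move=> hF; elim: r => [|i r IH].
  by apply: form_ext (form_zero m) => x; rewrite big_nil.
by apply: form_ext (formD (hF i) IH) => x; rewrite big_cons.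
Qed.

(** Splitting off the pure power of the second coordinate, which allows
    inductions on the degree. *)
Lemma form_recr m f : form m.+1 f <->
  exists g a, form m g /\ forall x, f x = x 0 0 * g x + a * x 0 1 ^+ m.+1.
Proof.
split.
  move=> [c hc].
  exists (fun x => \sum_(i < m.+1) c i * (x 0 0 ^+ (m - i) * x 0 1 ^+ i)), (c m.+1).
  split; first by exists c.
  move=> x; rewrite hc big_ord_recr /= subnn expr0 mul1r; congr (_ + _).
  rewrite mulr_sumr; apply: eq_bigr => i _.
  have im : (i <= m)%N by rewrite -ltnS.
  by rewrite (subSn im) exprS -mulrA mulrCA.
move=> [g [a [[c hc] hf]]].
exists (fun i => if i == m.+1 then a else c i) => x.
rewrite hf hc [RHS]big_ord_recr /= eqxx subnn expr0 mul1r; congr (_ + _).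
rewrite mulr_sumr; apply: eq_bigr => i _.
have im : (i <= m)%N by rewrite -ltnS.
by rewrite (ltn_eqF (ltn_ord i)) (subSn im) exprS -mulrA mulrCA.
Qed.

Lemma form_mulX0 m f : form m f -> form m.+1 (fun x => x 0 0 * f x).
Proof.
by move=> hf; apply/form_recr; exists f, 0; split=> // x; rewrite mul0r addr0.
Qed.

Lemma form_mulX1 m f : form m f -> form m.+1 (fun x => x 0 1 * f x).
Proof.
elim: m f => [|m IH] f.
  move=> [c hc]; apply/form_recr; exists (fun=> 0), (c 0%N); split.
    exact: form_zero.
  by move=> x; rewrite hc big_ord1; ring.
move=> /form_recr[g [a [hg hf]]]; apply/form_recr.
exists (fun x => x 0 1 * g x), a; split; first exact: IH.
by move=> x; rewrite hf [in RHS]exprS; ring.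
Qed.

Lemma form_br m u f : form m f -> form m.+1 (fun x => br u x * f x).
Proof.
move=> hf; apply: form_ext (formD (formZ (u 0 0) (form_mulX1 hf))
  (formZ (- u 0 1) (form_mulX0 hf))) => x.
by rewrite /br; ring.
Qed.

Lemma form_prod_br (I : Type) (r : seq I) (t : I -> 'rV[K]_2) m f : form m f ->
  form (size r + m) (fun x => (\prod_(i <- r) br (t i) x) * f x).
Proof.
move=> hf; elim: r => [|i r IH] /=.
  by apply: form_ext hf => x; rewrite big_nil mul1r.
by apply: form_ext (form_br (t i) IH) => x; rewrite big_cons mulrA.
Qed.

(** By induction on the degree: the power of x1 in f is traded, by means of
    u0 x1 = br u x + u1 x0, for a multiple of br u x plus a multiple of x0, and
    the cofactor of x0 vanishes again at u. When u0 = 0 the bracket br u x is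
    itself a multiple of x0. *)
Lemma form_factor m f u : u != 0 -> form m.+1 f -> f u = 0 ->
  exists2 g, form m g & f =1 (fun x => br u x * g x).
Proof.
move=> u0; elim: m f => [|m IH] f /form_recr[g [a [hg hf]]] fu0.
  case: (hg) => c hc.
  have {}hf x : f x = c 0%N * x 0 0 + a * x 0 1.
    by rewrite hf hc big_ord1 /= subnn !expr0 expr1; ring.
  have [w hw] := exists_br1 u0.
  exists (fun=> f w); first exact: form_const.
  move=> x; have := br_cramer u w x; rewrite hw scale1r => ->.
  rewrite brDr !brZr brxx hw mulr0 add0r mulr1.
  move: fu0; rewrite !hf !mxE => fu0.
  have -> : c 0%N * (br x w * u 0 0 + br u x * w 0 0) +
    a * (br x w * u 0 1 + br u x * w 0 1) =
    br x w * (c 0%N * u 0 0 + a * u 0 1) + br u x * (c 0%N * w 0 0 + a * w 0 1).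
    by ring.
  by rewrite fu0 mulr0 add0r.
have [u00|u00] := eqVneq (u 0 0) 0.
  have u01 : u 0 1 != 0.
    by apply: contra_neq u0 => h1; apply: rV2_eq; rewrite mxE.
  move: fu0; rewrite hf u00 mul0r add0r => /eqP.
  rewrite mulf_eq0 expf_eq0 (negPf u01) andbF orbF => /eqP a0.
  exists (fun x => - (u 0 1)^-1 * g x); first exact: formZ.
  by move=> x; rewrite hf a0 /br u00; field.
have hk : form m.+1 (fun x => g x + (a * u 0 1 / u 0 0) * x 0 1 ^+ m.+1).
  apply: formD => //; apply: formZ; apply/form_recr; exists (fun=> 0), 1.
  by split=> [|x]; [exact: form_zero|rewrite mulr0 add0r mul1r].
have [|h hh he] := IH _ hk.
  apply: (mulfI u00); rewrite mulr0 -[RHS]fu0 hf [in RHS]exprSr.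
  by field.
exists (fun x => x 0 0 * h x + a / u 0 0 * x 0 1 ^+ m.+1).
  by apply/form_recr; exists h, (a / u 0 0).
move=> x; rewrite hf.
have -> : br u x * (x 0 0 * h x + a / u 0 0 * x 0 1 ^+ m.+1)
   = x 0 0 * (br u x * h x) + br u x * (a / u 0 0 * x 0 1 ^+ m.+1) by ring.
by rewrite -he /br [in LHS]exprS; field.
Qed.

(** Either the point (0 : 1) is a zero, or the dehomogenization has the full
    degree, hence a root. *)
Lemma form_has_zero m f : form m.+1 f -> exists2 u, u != 0 & f u = 0.
Proof.
move=> [c hc]; have [h|h] := eqVneq (c m.+1) 0.
  exists (delta_mx 0 1).
    by apply/eqP => /rowP/(_ 1); rewrite !mxE /= => /eqP; rewrite oner_eq0.
  rewrite hc big_ord_recr /= h mul0r addr0 big1 // => i _.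
  have im : (i <= m)%N by rewrite -ltnS.
  by rewrite !mxE /= (subSn im) expr0n /= mul0r mulr0.
have /closed_rootP[z] : size (\poly_(i < m.+2) c i) != 1%N.
  by rewrite size_poly_eq.
rewrite /root horner_poly => /eqP hz.
exists (delta_mx 0 0 + z *: delta_mx 0 1).
  apply/eqP => /rowP/(_ 0); rewrite !mxE /= mulr0 addr0 => /eqP.
  by rewrite oner_eq0.
rewrite hc -[RHS]hz; apply: eq_bigr => i _.
by rewrite !mxE /= mulr0 addr0 expr1n mul1r add0r mulr1.
Qed.

Lemma form_split m f : form m f -> exists c (t : 'I_m -> 'rV[K]_2),
  (forall i, t i != 0) /\ f =1 (fun x => c * \prod_(i < m) br (t i) x).
Proof.
elim: m f => [|m IH] f hf.
  case: hf => c hc; exists (c 0%N), (fun=> delta_mx 0 0); split; first by case.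
  by move=> x; rewrite hc big_ord1 big_ord0 !expr0 mulr1.
have [u u0 fu0] := form_has_zero hf.
have [g /IH[c [t [ht hg]]] he] := form_factor u0 hf fu0.
exists c, (fun i => oapp t u (unlift ord0 i)); split.
  by move=> i; case: (unlift ord0 i) => [j|] /=.
move=> x; rewrite he hg big_ord_recl unlift_none /= mulrCA.
by do 2!congr (_ * _); apply: eq_bigr => i _; rewrite liftK.
Qed.

Lemma form_eq0 m f (ss : seq 'rV[K]_2) : form m f -> (m < size ss)%N ->
  (forall s, s \in ss -> s != 0 /\ f s = 0) ->
  pairwise (fun x y => br x y != 0) ss -> forall x, f x = 0.
Proof.
elim: m f ss => [|m IH] f [//|u ss] hf hs hz /= /andP[/allP hu hp] x.
all: have [u0 fu0] := hz u (mem_head _ _).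
  by case: hf fu0 => c hc; rewrite !hc !big_ord1 !expr0.
have [g hg he] := form_factor u0 hf fu0.
rewrite he (IH g ss) ?mulr0 // => s hs'.
have [s0 fs0] : s != 0 /\ f s = 0 by apply: hz; rewrite inE hs' orbT.
split=> //; move/eqP: fs0; rewrite he mulf_eq0 (negPf (hu _ hs')).
by move/eqP.
Qed.

Lemma form_eq0_family m f (I : finType) (A : {pred I}) (s : I -> 'rV[K]_2) :
  form m f -> (m < #|A|)%N -> (forall i, i \in A -> s i != 0) ->
  {in A &, forall i j, i != j -> br (s i) (s j) != 0} ->
  (forall i, i \in A -> f (s i) = 0) -> forall x, f x = 0.
Proof.
move=> hf hA s0 hs hz.
apply: (form_eq0 (ss := [seq s i | i <- enum A])) hf _ _ _.
- by rewrite size_map -cardE.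
- by move=> v /mapP[i]; rewrite mem_enum => iA ->; split; [exact: s0|exact: hz].
- have hu : pairwise [rel x y | x != y] (enum A).
    by rewrite -uniq_pairwise enum_uniq.
  rewrite pairwise_map.
  refine (sub_in_pairwise (P := mem A) _ _ hu).
    by move=> i j iA jA; exact: hs.
  by apply/allP => i; rewrite mem_enum.
Qed.

(** Homogeneity makes vanishing at a vector depend only on the point that the
    vector represents. *)
Lemma form_scale m f a x : form m f -> f (a *: x) = a ^+ m * f x.
Proof.
move=> [c hc]; rewrite !hc mulr_sumr; apply: eq_bigr => i _.
have im : (i <= m)%N by rewrite -ltnS.
have -> : a ^+ m = a ^+ (m - i) * a ^+ i by rewrite -exprD subnK.
rewrite !mxE !exprMn; set p := a ^+ (m - i); set q := _ ^+ (m - i); ring.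
Qed.

Lemma form_zero_class m f x y : form m f -> x != 0 -> y != 0 -> br x y = 0 ->
  f x = 0 -> f y = 0.
Proof.
move=> hf x0 y0 h fx; have [a _ ->] := br_colinear x0 y0 h.
by rewrite (form_scale _ _ hf) fx mulr0.
Qed.

Lemma form_mul m k f g : form m f -> form k g -> form (m + k) (fun x => f x * g x).
Proof.
move=> /form_split[c [t [_ hf]]] hg.
have := formZ c (form_prod_br (enum 'I_m) t hg); rewrite size_enum_ord.
by apply: form_ext => x; rewrite hf mulrA big_enum.
Qed.

(** The field is infinite: on the affine line of the points (1 : z), lying away
    from t is the nonvanishing of a nonzero polynomial in z. *)
Lemma avoid_points (ts : seq 'rV[K]_2) : (forall t, t \in ts -> t != 0) ->
  exists2 x, x != 0 & forall t, t \in ts -> br t x != 0.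
Proof.
move=> ht.
pose l t : {poly K} := (t 0 0) *: 'X - (t 0 1)%:P.
have lE t (z : K) : (l t).[z] = br t (delta_mx 0 0 + z *: delta_mx 0 1).
  by rewrite /br !hornerE /= !mxE /=; ring.
have /closed_nonrootP[z] : \prod_(t <- ts) l t != 0.
  rewrite prodf_seq_neq0; apply/allP => t /ht t0 /=.
  apply: contra_neq t0 => h; apply: rV2_eq; rewrite mxE.
    by have := congr1 (fun p : {poly K} => p`_1) h; rewrite !coefE /= mulr1 subr0.
  have := congr1 (fun p : {poly K} => p`_0) h; rewrite !coefE /= mulr0 sub0r.
  by move/eqP; rewrite oppr_eq0 => /eqP.
rewrite /root horner_prod prodf_seq_neq0 => /allP hz.
exists (delta_mx 0 0 + z *: delta_mx 0 1).
  apply/eqP => /rowP/(_ 0); rewrite !mxE /= mulr0 addr0 => /eqP.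
  by rewrite oner_eq0.
by move=> t /hz /=; rewrite lE.
Qed.

Lemma form_neq0_mul m k f g x y : form m f -> form k g -> f x != 0 -> g y != 0 ->
  exists2 z, z != 0 & f z * g z != 0.
Proof.
move=> /form_split[c [t [ht hf]]] /form_split[d [u [hu hg]]].
rewrite hf hg !mulf_eq0 !negb_or => /andP[c0 _] /andP[d0 _].
have [v|z z0 hz] := @avoid_points (codom t ++ codom u).
  by rewrite mem_cat => /orP[] /codomP[i ->].
exists z => //; rewrite hf hg !mulf_neq0 //; apply/prodf_neq0 => i _;
  by apply: hz; rewrite mem_cat codom_f ?orbT.
Qed.

Lemma form_line m f u w : form m f -> exists p : {poly K},
  forall z : K, p.[z] = f (u + z *: w).
Proof.
move=> [c hc].
exists (\sum_(i < m.+1) c i *: (((u 0 0)%:P + w 0 0 *: 'X) ^+ (m - i) *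
   ((u 0 1)%:P + w 0 1 *: 'X) ^+ i)) => z.
rewrite horner_sum hc; apply: eq_bigr => i _.
by rewrite !hornerE !mxE /= !(mulrC z).
Qed.

Lemma poly_eq_horner (p q : {poly K}) : (forall z : K, p.[z] = q.[z]) -> p = q.
Proof.
move=> h; apply/eqP; rewrite -subr_eq0; apply/negPn/negP => /closed_nonrootP[z].
by rewrite /root !hornerE h subrr eqxx.
Qed.

(** A linear factor can be cancelled even at its own zero u: along a line
    through u both sides are polynomials in the parameter, and the bracket is
    that parameter. *)
Lemma form_cancel m k f g u : u != 0 -> form m f -> form k g ->
  (forall x, br u x * f x = br u x * g x) -> f u = g u.
Proof.
move=> u0 hf hg h; have [w hw] := exists_br1 u0.
have [p hp] := form_line u w hf; have [q hq] := form_line u w hg.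
(* Since br u w = 1, the bracket br u (u + z w) is z itself. *)
have e : 'X * p = 'X * q.
  apply: poly_eq_horner => z; rewrite !hornerE hp hq.
  by have := h (u + z *: w); rewrite brDr brZr brxx hw add0r mulr1.
have := congr1 (horner^~ 0) (mulfI (negbT (polyX_eq0 _)) e).
by rewrite hp hq scale0r addr0.
Qed.

End Forms.

Section Zeros.
Variable K : closedFieldType.
Implicit Types (x y z t u w : 'rV[K]_2) (f g : 'rV[K]_2 -> K) (m n : nat).

Lemma form_zeros m f x : form m f -> f x != 0 ->
  exists2 ts : seq 'rV[K]_2, (forall t, t \in ts -> t != 0) &
    forall y, f y = 0 -> exists2 t, t \in ts & br t y = 0.
Proof.
move=> /form_split[c [t [ht hf]]]; rewrite hf mulf_eq0 negb_or => /andP[c0 _].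
exists (codom t); first by move=> y /codomP[i ->].
move=> y /eqP; rewrite hf mulf_eq0 (negPf c0) => /prodf_eq0[i _ /eqP h].
by exists (t i) => //; exact: codom_f.
Qed.

(** A nonzero form of degree n that has n known distinct zeros has no other one.
    The known zeros are indexed by I without i, with #|I| = n + 1, as are the
    vertices of a pyramid on one of its faces. *)
Lemma form_zero_among n f (I : finType) (t : I -> 'rV[K]_2) i x u :
  form n f -> f x != 0 -> #|I| = n.+1 ->
  (forall k, k != i -> t k != 0 /\ f (t k) = 0) ->
  (forall k l, k != i -> l != i -> k != l -> br (t k) (t l) != 0) ->
  u != 0 -> f u = 0 -> exists2 k, k != i & br (t k) u = 0.
Proof.
move=> hf fx cI t0 td u0 fu.
have [/existsP[k /andP[ki /eqP h]]|/existsPn h] :=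
  boolP [exists k, (k != i) && (br (t k) u == 0)]; first by exists k.
have {}h k : k != i -> br (t k) u != 0.
  by move=> ki; have := h k; rewrite ki.
case/eqP: fx.
(* Otherwise u in place of t i gives n + 1 distinct zeros. *)
apply: (@form_eq0_family _ n f I predT (fun k => if k == i then u else t k)) => //.
- by rewrite cI.
- by move=> k _; case: (eqVneq k i) => [//|ki]; have [] := t0 k ki.
- move=> k l _ _; case: (eqVneq k i) => [->|ki]; case: (eqVneq l i) => [_|li] //.
  + by move=> _; rewrite br_eq0C h.
  + by move=> _; rewrite h.
  + exact: td.
- by move=> k _; case: (eqVneq k i) => [//|ki]; have [] := t0 k ki.
Qed.

End Zeros.

(** * Correspondences of type (n, n) attached to a pencil *)

(** What is needed of a correspondence E of bidegree (n, n) on the projective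
    line whose pairs of points are the pairs of points in a fibre of a map
    (P : Q) of degree n + 1; the diagonal x = y is removed from the relation
    P(x) Q(y) = P(y) Q(x) by dividing it by br x y. *)
Record pencil_corr (K : closedFieldType) (n : nat)
    (E : 'rV[K]_2 -> 'rV[K]_2 -> K) : Prop := PencilCorr {
  pencil_forml : forall y, form n (E^~ y);
  pencil_diag : form (n + n) (fun x => E x x);
  pencil_diag_neq0 : exists x, E x x != 0;
  pencil_sym : forall x y, E x y = E y x;
  pencil_nondeg : forall x, x != 0 -> exists y, E x y != 0;
  pencil_rel : exists P Q : 'rV[K]_2 -> K,
    forall x y, br x y * E x y = P x * Q y - P y * Q x }.

(** For a pencil correspondence and n + 1 indices, this is a fibre without
    repeated points. *)
Definition selfpolar (K : closedFieldType) (E : 'rV[K]_2 -> 'rV[K]_2 -> K)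
    (I : finType) (s : I -> 'rV[K]_2) : Prop :=
  [/\ forall i, s i != 0,
      forall i j, i != j -> br (s i) (s j) != 0
    & forall i j, (E (s i) (s j) == 0) = (i != j)].

Section Interpolation.
Variables (K : closedFieldType) (n : nat) (I : finType) (s : I -> 'rV[K]_2).
Hypothesis cardI : #|I| = n.+1.
Hypothesis s_neq0 : forall i, s i != 0.
Hypothesis s_distinct : forall i j, i != j -> br (s i) (s j) != 0.
Implicit Types (x y : 'rV[K]_2).

Definition lagrange i x : K := \prod_(j | j != i) br (s j) x.

Lemma form_lagrange i : form n (lagrange i).
Proof.
have := form_prod_br (enum (predC1 i)) s (form_const 1).
rewrite addn0 -cardE cardC1 cardI /=; apply: form_ext => x.
by rewrite mulr1 big_enum.
Qed.

Lemma lagrange_eq0 i j : (lagrange i (s j) == 0) = (i != j).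
Proof.
have [<-|ij] := eqVneq i j.
  by apply/negbTE/prodf_neq0 => k ki; exact: s_distinct.
by rewrite /lagrange (bigD1 j) 1?eq_sym //= brxx mul0r eqxx.
Qed.

(** Both sides are forms of degree n which agree at n + 1 points. *)
Lemma lagrange_interpolation f x : form n f ->
  f x = \sum_i f (s i) / lagrange i (s i) * lagrange i x.
Proof.
move=> hf; apply/eqP; rewrite -subr_eq0; apply/eqP; move: x.
pose g x := f x + -1 * \sum_i f (s i) / lagrange i (s i) * lagrange i x.
have hg : form n g.
  by apply: formD => //; apply: formZ; apply: form_sum => i; apply: formZ;
     exact: form_lagrange.
have gz : forall x, g x = 0.
  apply: (form_eq0_family (A := predT) (s := s) hg); rewrite ?cardI //.
    by move=> i j _ _; exact: s_distinct.
  move=> i _; rewrite /g (bigD1 i) //= big1 => [|j ji]; last first.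
    by have /eqP-> : lagrange j (s i) == 0; rewrite ?lagrange_eq0 // mulr0.
  rewrite divfK ?lagrange_eq0 ?eqxx //.
  by rewrite addr0 mulN1r subrr.
by move=> x; rewrite -mulN1r; exact: gz.
Qed.

End Interpolation.

Section PencilOfSystem.
Variables (K : closedFieldType) (n : nat) (I : finType).
Variables (s : I -> 'rV[K]_2) (E : 'rV[K]_2 -> 'rV[K]_2 -> K).
Hypothesis cardI : #|I| = n.+1.
Hypothesis hs : selfpolar E s.
Hypothesis Efl : forall y, form n (E^~ y).
Hypothesis Efr : forall x, form n (E x).
Implicit Types (x y : 'rV[K]_2).

Let L := lagrange s.
Let c i := E (s i) (s i) / L i (s i) / L i (s i).

(** Interpolation in each of the two variables: only the values E (s i) (s i) on
    the diagonal survive. *)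
Lemma selfpolar_diagonal x y : E x y = \sum_i c i * (L i x * L i y).
Proof.
case: hs => s0 sd sE.
rewrite (lagrange_interpolation cardI s0 sd x (Efl y)); apply: eq_bigr => i _.
rewrite (lagrange_interpolation cardI s0 sd y (Efr (s i))) (bigD1 i) //= big1.
  by rewrite addr0 /c -/L; ring.
by move=> j ji; have /eqP-> : E (s i) (s j) == 0; rewrite ?sE 1?eq_sym // !mul0r.
Qed.

(** The forms of the pencil are the product P of all br (s i) x and the
    combination Q of the br x (e i) * L i x, where e i is chosen with
    br (s i) (e i) = 1; the summand of index i of br x y * E x y splits by the
    Pluecker identity for x, y, s i and e i. *)
Lemma pencil_of_selfpolar : pencil_corr n E.
Proof.
case: (hs) => s0 sd sE.
have c0 i : c i != 0.
  by rewrite /c !mulf_neq0 ?invr_eq0 ?sE ?(lagrange_eq0 sd) ?eqxx.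
have [i0 _] : exists i0, i0 \in I by apply/card_gt0P; rewrite cardI.
split.
- exact: Efl.
- apply: form_ext (form_sum (m := n + n) (index_enum I)
    (F := fun i x => c i * (L i x * L i x)) _).
    by move=> x; rewrite selfpolar_diagonal.
  by move=> i; apply: formZ; apply: form_mul; exact: form_lagrange.
- by exists (s i0); rewrite sE eqxx.
- move=> x y; rewrite !selfpolar_diagonal; apply: eq_bigr => i _.
  by rewrite (mulrC (L i x)).
- move=> x x0; apply: contrapT => h.
  (* All L i would vanish at x. The vanishing of L i0 at x makes x one of the
     points s j, and that of L j makes it a second one. *)
  have hL i : L i x = 0.
    have : E x (s i) = 0 by apply/eqP/negPn/negP => e; apply: h; exists (s i).
    rewrite selfpolar_diagonal (bigD1 i) //= big1 => [|j ji].
      move/eqP; rewrite addr0 mulf_eq0 (negPf (c0 i)) mulf_eq0.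
      by rewrite (lagrange_eq0 sd) eqxx orbF => /eqP.
    by have /eqP-> : L j (s i) == 0; rewrite ?(lagrange_eq0 sd) // !mulr0.
  have /prodf_eq0[j _ /eqP hj] : L i0 x == 0 by rewrite hL.
  have /prodf_eq0[k kj /eqP hk] : L j x == 0 by rewrite hL.
  have /negP := sd _ _ kj; apply; apply/eqP; apply: (br_trans x0 hk).
  by rewrite brC hj oppr0.
- have [e he] := choice (fun i => exists_br1 (s0 i)).
  exists (fun x => \prod_i br (s i) x),
         (fun y => - \sum_i c i * (br y (e i) * L i y)) => x y.
  rewrite selfpolar_diagonal !mulrN !mulr_sumr -!sumrN -!big_split /=.
  apply: eq_bigr => i _.
  rewrite !(bigD1 (P := xpredT) i) //= -!/(lagrange s i _) -/L.
  have -> : br x y = br x y * br (s i) (e i) by rewrite he mulr1.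
  by rewrite br_plucker (brC (s i) x) (brC (s i) y); ring.
Qed.

End PencilOfSystem.

Section PencilTheory.
Variables (K : closedFieldType) (n : nat) (E : 'rV[K]_2 -> 'rV[K]_2 -> K).
Hypothesis hE : pencil_corr n E.
Implicit Types (x y z t u w : 'rV[K]_2).

Lemma pencil_formr x : form n (E x).
Proof. by apply: form_ext (pencil_forml hE x) => y; rewrite (pencil_sym hE). Qed.

Let Om x y := br x y * E x y.

(** The form br x y * E x y is a 2 x 2 minor of the values of (P, Q), hence
    satisfies the same quadratic relation as the bracket. *)
Lemma pencil_plucker x y z t : Om x y * Om z t = Om x z * Om y t - Om x t * Om y z.
Proof. by rewrite /Om; case: (pencil_rel hE) => P [Q h]; rewrite !h; ring. Qed.

Lemma pencil_rel_sym x y : Om x y = 0 -> Om y x = 0.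
Proof.
by rewrite /Om (pencil_sym hE) brC mulNr => /eqP; rewrite oppr_eq0 => /eqP.
Qed.

(** No fibre is the whole line; equivalently P and Q have no common zero. *)
Lemma pencil_rel_nontrivial x : x != 0 -> exists y, Om x y != 0.
Proof.
move=> x0; have [y hy] := pencil_nondeg hE x0.
have [w hw] := exists_br1 x0.
have hf : form 1 (br x).
  by apply: form_ext (form_br x (form_const 1)) => v; rewrite mulr1.
have hw1 : br x w != 0 by rewrite hw oner_eq0.
by have [z _ hz] := form_neq0_mul hf (pencil_formr x) hw1 hy; exists z.
Qed.

(** Being in the same fibre is transitive, as a consequence of the quadratic
    relation and of the nontriviality of the fibre of z. *)
Lemma pencil_rel_trans z x y : z != 0 -> Om x z = 0 -> Om z y = 0 -> Om x y = 0.
Proof.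
move=> z0 xz zy; have [w hw] := pencil_rel_nontrivial z0.
apply: (mulIf hw); rewrite mul0r pencil_plucker xz (pencil_rel_sym zy).
by rewrite mul0r mulr0 subrr.
Qed.

Lemma pencil_classr x y z : y != 0 -> z != 0 -> br y z = 0 ->
  E x y = 0 -> E x z = 0.
Proof. exact: form_zero_class (pencil_formr x). Qed.

Lemma pencil_classl x y z : y != 0 -> z != 0 -> br y z = 0 ->
  E y x = 0 -> E z x = 0.
Proof. exact: (form_zero_class (pencil_forml hE x)). Qed.

(** The n zeros of E (s i) are already found among the s k. *)
Lemma selfpolar_fibre (I : finType) (s : I -> 'rV[K]_2) i u :
  #|I| = n.+1 -> selfpolar E s -> u != 0 -> Om (s i) u = 0 ->
  exists k, br (s k) u = 0.
Proof.
move=> cI [s0 sd sE] u0 /eqP; rewrite /Om mulf_eq0 => /orP[/eqP|/eqP] h.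
  by exists i.
have fx : E (s i) (s i) != 0 by rewrite sE eqxx.
have z0 k : k != i -> s k != 0 /\ E (s i) (s k) = 0.
  by move=> ki; split=> //; apply/eqP; rewrite sE eq_sym.
have [k _ hk] := form_zero_among (pencil_formr (s i)) fx cI z0
  (fun k l _ _ => @sd k l) u0 h.
by exists k.
Qed.

(** Two vertices s i and s j are both in the fibre of a third contact t k, hence
    in the same fibre; this is where n >= 2 is used. So E vanishes at all pairs
    of distinct vertices, and it cannot vanish at (s j, s j), as E (s j) would
    then have n + 1 zeros. Now s j is a zero of E (s i), all of whose n zeros are
    among the t k, and k = j is the only index for which E (s j) (t k) may be
    different from 0. *)
Lemma incident_pairs_selfpolar (I : finType) (s t : I -> 'rV[K]_2) :
  (2 <= n)%N -> #|I| = n.+1 ->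
  (forall i, s i != 0) -> (forall i, t i != 0) ->
  (forall i j, i != j -> br (s i) (s j) != 0) ->
  (forall i j, (E (s i) (t j) == 0) = (i != j)) ->
  selfpolar E s /\ forall i, br (s i) (t i) = 0.
Proof.
move=> n2 cI s0 t0 sd stE.
have st i j : i != j -> E (s i) (t j) = 0 by move=> ij; apply/eqP; rewrite stE.
have td i j : i != j -> br (t i) (t j) != 0.
  move=> ij; apply/eqP => h.
  have := stE j j; rewrite eqxx => /eqP; apply.
  by apply: (pencil_classr (t0 i) (t0 j) h); apply: st; rewrite eq_sym.
(* At most two of the n + 1 >= 3 indices are excluded. *)
have third (i j : I) : exists k, k != i /\ k != j.
  have /card_gt0P[k] : (0 < #|[predC pred2 i j]|)%N.
    rewrite -(ltn_add2l #|pred2 i j|) addn0 cardC cI card2.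
    by rewrite ltnS (leq_trans _ n2) //; case: (i != j).
  by rewrite inE /= negb_or => /andP[ki kj]; exists k.
have ss i j : i != j -> E (s i) (s j) = 0.
  move=> ij; have [k [ki kj]] := third i j.
  have : Om (s i) (s j) = 0.
    apply: (pencil_rel_trans (t0 k)).
      by rewrite /Om st ?mulr0 // eq_sym.
    by apply: pencil_rel_sym; rewrite /Om st ?mulr0 // eq_sym.
  by move/eqP; rewrite mulf_eq0 (negPf (sd _ _ ij)) => /eqP.
have ssd i : E (s i) (s i) != 0.
  apply/eqP => h; have [y /eqP] := pencil_nondeg hE (s0 i); apply.
  rewrite (pencil_sym hE).
  apply: (form_eq0_family (A := predT) (s := s) (pencil_forml hE (s i))).
  - by rewrite cI.
  - by [].
  - by move=> j k _ _; exact: sd.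
  - by move=> j _; have [->|ji] := eqVneq j i; last exact: ss.
split.
  split=> // i j; have [->|ij] := eqVneq i j; first exact: negbTE.
  by rewrite ss // eqxx.
move=> j; have [i [ij _]] := third j j.
have fx : E (s i) (t i) != 0 by rewrite stE eqxx.
have z0 k : k != i -> t k != 0 /\ E (s i) (t k) = 0.
  by move=> ki; split=> //; apply: st; rewrite eq_sym.
have [k ki hk] := form_zero_among (pencil_formr (s i)) fx cI z0
  (fun k l _ _ => @td k l) (s0 j) (ss i j ij).
have [e|kj] := eqVneq k j; first by rewrite brC -[in t j]e hk oppr0.
case/eqP: (ssd j); apply: (pencil_classr (t0 k) (s0 j) hk).
by apply: st; rewrite eq_sym.
Qed.

(** If t i is a double zero of E x, it is a double zero of the member
    br x y * E x y of the pencil. That member is proportional to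
    br (t i) y * E (t i) y, from which one factor br (t i) y cancels. *)
Lemma pencil_double_root x c (t : 'I_n -> 'rV[K]_2) i j :
  x != 0 -> (forall i, t i != 0) ->
  (forall y, E x y = c * \prod_(k < n) br (t k) y) ->
  i != j -> br (t i) (t j) = 0 -> E (t i) (t i) = 0.
Proof.
move=> x0 t0 hE' ij h; set T := t i.
pose G y := (\prod_(k <- enum (predC1 i)) br (t k) y) * c.
have EG y : E x y = br T y * G y.
  by rewrite hE' (bigD1 i) //= /G big_enum /=; ring.
have G0 : G T = 0.
  rewrite /G big_enum (bigD1 j) ?inE 1?eq_sym //=.
  by rewrite brC h oppr0 !mul0r.
(* The point w only serves to name the factor of proportionality between the
   members of the pencil through x and through T. *)
have [w hw] := pencil_rel_nontrivial x0.
have xT : Om x T = 0 by rewrite /Om EG brxx mul0r mulr0.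
have hfG : form _ (fun y => Om T w * (br x y * G y)) :=
  formZ (Om T w) (form_br x (form_prod_br (enum (predC1 i)) t (form_const c))).
have := form_cancel (u := T) (t0 i) (formZ (Om x w) (pencil_formr T)) hfG.
rewrite G0 !mulr0 => hc.
apply: (mulfI hw); rewrite mulr0; apply: hc => y.
have := pencil_plucker x y T w; rewrite xT mul0r sub0r {1}/Om EG => e.
have {}e : Om x w * Om T y = br x y * (br T y * G y) * Om T w.
  by rewrite e /Om (brC T y) (pencil_sym hE T y); ring.
have -> : br T y * (Om x w * E T y) = Om x w * Om T y by rewrite /Om; ring.
by rewrite e; ring.
Qed.

(** The points to avoid are those in the fibres of the zeros of E z z, so that
    no point of the fibre of x is a multiple one. The fibre consists of x (index
    None) and of the n zeros of E x. *)
Lemma pencil_generic_fibre : exists2 bad : seq 'rV[K]_2,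
  (forall b, b \in bad -> b != 0) &
  forall x, x != 0 -> (forall b, b \in bad -> br b x != 0) ->
  exists2 s : option 'I_n -> 'rV[K]_2, s None = x & selfpolar E s.
Proof.
have [d hd] := pencil_diag_neq0 hE.
have [zs zs0 hzs] := form_zeros (pencil_diag hE) hd.
have /choice[Z hZ] z : exists ts : seq 'rV[K]_2, z != 0 ->
    (forall t, t \in ts -> t != 0) /\
    forall y, E z y = 0 -> exists2 t, t \in ts & br t y = 0.
  have [->|z0] := eqVneq z 0; first by exists [::].
  have [y hy] := pencil_nondeg hE z0.
  by have [ts ? ?] := form_zeros (pencil_formr z) hy; exists ts.
exists (zs ++ flatten [seq Z z | z <- zs]).
  move=> b; rewrite mem_cat => /orP[/zs0//|/flatten_mapP[z /zs0 z0]].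
  by have [h _] := hZ z z0; exact: h.
move=> x x0 hx.
(* If x were equal to some t i, or some t i were repeated, then some point z of
   the fibre of x would satisfy E z z = 0. *)
have xz : E x x != 0.
  apply/eqP => /hzs[t tz h]; have := hx t; rewrite mem_cat tz h eqxx.
  by move/(_ isT).
have dx t : t != 0 -> E x t = 0 -> E t t != 0.
  move=> t0 xt; apply/eqP => /hzs[z zz h].
  have [_ /(_ x)[|u uz hu]] := hZ z (zs0 z zz).
    rewrite (pencil_sym hE); apply: (pencil_classr t0 (zs0 _ zz) _ xt).
    by rewrite brC h oppr0.
  have := hx u; rewrite mem_cat hu eqxx.
  suff -> : u \in flatten [seq Z z | z <- zs] by rewrite orbT => /(_ isT).
  by apply/flatten_mapP; exists z.
have [c [t [t0 hEx]]] := form_split (pencil_formr x).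
have xt i : E x (t i) = 0 by rewrite hEx (bigD1 i) //= brxx mul0r mulr0.
have xnt i : br x (t i) != 0.
  apply: contra_neq (dx _ (t0 i) (xt i)) => h.
  exact: (pencil_classl x0 (t0 i) h).
have td i j : i != j -> br (t i) (t j) != 0.
  move=> ij; apply: contra_neq (dx _ (t0 i) (xt i)).
  exact: pencil_double_root x0 t0 hEx ij.
have tt i j : i != j -> E (t i) (t j) = 0.
  move=> ij; have : Om (t i) (t j) = 0.
    apply: (pencil_rel_trans x0); last by rewrite /Om xt mulr0.
    by apply: pencil_rel_sym; rewrite /Om xt mulr0.
  by move/eqP; rewrite mulf_eq0 (negPf (td _ _ ij)) => /eqP.
exists (fun o => if o is Some i then t i else x) => //; split.
- by case.
- move=> [i|] [j|] //.
  + exact: td.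
  + by rewrite br_eq0C.
- move=> [i|] [j|].
  + have [[->]|ij] := eqVneq (Some i) (Some j); first exact: negbTE (dx _ _ _).
    by rewrite tt ?eqxx //.
  + by rewrite (pencil_sym hE) xt eqxx.
  + by rewrite xt eqxx.
  + exact: negbTE.
Qed.

End PencilTheory.

(** * Pyramids and dual families of equations *)

Section PyramidDuality.
Variables (K : closedFieldType) (n : nat).
Implicit Types (D : {fset subsp K n}) (p q : subsp K n).
Implicit Types (v w : 'rV[K]_n.+1) (a : 'cV[K]_n.+1).

Lemma dim_full_rV : \dim (fullv : subsp K n) = n.+1.
Proof. by rewrite dimvf; exact: mul1n. Qed.

Lemma sumv_sub_kernel (r : seq (subsp K n)) a w :
  (forall p, p \in r -> forall v, v \in p -> v *m a = 0) ->
  w \in (\sum_(p <- r) p)%VS -> w *m a = 0.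
Proof.
elim: r w => [|p r IH] w h.
  by rewrite big_nil memv0 => /eqP ->; rewrite mul0mx.
rewrite big_cons => /memv_addP[v1 v1p [v2 v2r ->]].
rewrite mulmxDl (h p) ?mem_head // IH ?addr0 // => q qr.
by apply: h; rewrite inE qr orbT.
Qed.

Lemma sumv_seq_sup (r : seq (subsp K n)) p : p \in r -> (p <= \sum_(q <- r) q)%VS.
Proof. by move=> pr; rewrite (big_rem p) //= addvSl. Qed.

(** A vertex lies on all faces but the opposite one: otherwise that face would
    contain all the vertices, whereas n points span a proper subspace. *)
Lemma pyramid_dual D (v : subsp K n -> 'rV[K]_n.+1)
    (a : subsp K n -> 'cV[K]_n.+1) :
  pyramid D -> (forall p, p \in D -> p = <[v p]>%VS) ->
  (forall p, p \in D -> is_equation (face D p) (a p)) ->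
  forall p q, p \in D -> q \in D -> (v p *m a q == 0) = (p != q).
Proof.
case=> cD dD sD vD aD p q pD qD.
rewrite -(aD q qD); have [<-|pq] := eqVneq p q; last first.
  apply: (subvP (sumv_seq_sup (p := p) _)); first by rewrite in_fsetD1 pq.
  by rewrite {2}(vD p pD) memv_line.
apply/negbTE/negP => vf.
have : (fullv <= face D p)%VS.
  rewrite -sD (big_fsetD1 p) //= subv_add subvv andbT.
  by rewrite [p in (p <= _)%VS]vD // -memvE.
move/dimvS; apply/negP; rewrite -ltnNge dim_full_rV ltnS.
apply: leq_trans (dimv_leq_sum _ _ _) _.
rewrite (eq_big_seq (fun=> 1%N)); last first.
  by move=> r; rewrite in_fsetD1 => /andP[_ /dD].
rewrite big_const_seq count_predT iter_addn_0 mul1n.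
by have := cardfsD1 p D; rewrite cD pD add1n => /succn_inj <-.
Qed.

Variables (I : finType) (v : I -> 'rV[K]_n.+1) (a : I -> 'cV[K]_n.+1).
Hypothesis cardI : #|I| = n.+1.
Hypothesis dual : forall i j, (v i *m a j == 0) = (i != j).

Lemma dual_coord (k : I -> K) j :
  (\sum_i k i *: v i) *m a j = k j *: (v j *m a j).
Proof.
rewrite mulmx_suml (bigD1 j) //= big1 ?addr0 ?scalemxAl // => i ij.
have /eqP h : v i *m a j == 0 by rewrite dual.
by rewrite -scalemxAl h scaler0.
Qed.

(** A family with a dual family of equations is free, hence a basis when it has
    n + 1 members. *)
Lemma dual_span w : exists k : I -> K, w = \sum_i k i *: v i.
Proof.
pose X := [tuple v (enum_val i) | i < #|I|].
have nthX (j : 'I_#|I|) : X`_j = v (enum_val j) by rewrite -tnth_nth tnth_mktuple.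
have bX : basis_of fullv X.
  have nI : (n < #|I|)%N by rewrite cardI.
  rewrite basisEfree subvf dim_full_rV size_tuple nI !andbT.
  apply/freeP => k hk j.
  have : (\sum_(i < #|I|) k i *: X`_i) *m a (enum_val j) = 0 by rewrite hk mul0mx.
  rewrite mulmx_suml (bigD1 j) //= big1 => [|i ij]; last first.
    rewrite nthX -scalemxAl.
    have /eqP -> : v (enum_val i) *m a (enum_val j) == 0.
      by rewrite dual (inj_eq enum_val_inj).
    by rewrite scaler0.
  rewrite addr0 nthX -scalemxAl => /eqP.
  by rewrite scaler_eq0 dual eqxx orbF => /eqP.
have : w \in <<X>>%VS by rewrite (span_basis bX) memvf.
move/coord_span => hw; exists (fun i => coord X (enum_rank i) w).
rewrite {1}hw [RHS](reindex _ (onW_bij _ (@enum_val_bij I))) /=.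
by apply: eq_bigr => j _; rewrite nthX enum_valK.
Qed.

Definition family_points : {fset subsp K n} := [fset <[v i]>%VS | i in I].

Lemma family_pointsP p : reflect (exists i, p = <[v i]>%VS) (p \in family_points).
Proof.
apply: (iffP (imfsetP _ _ _ _)) => [[i _ ->]|[i ->]]; by exists i.
Qed.

Lemma family_points_inj : injective (fun i => <[v i]>%VS).
Proof.
move=> i j h; apply/eqP; rewrite -[_ == _]negbK -dual; apply/negP => h0.
have := memv_line (v j); rewrite -h => /vlineP[k hk].
have := dual j j; rewrite eqxx => /negP; apply.
by rewrite hk -scalemxAl (eqP h0) scaler0.
Qed.

Lemma family_pyramid : pyramid family_points.
Proof.
split.
- by rewrite card_imfset -?cardI ?cardE //; exact: family_points_inj.
- move=> _ /family_pointsP[i ->]; rewrite dim_vline.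
  case: eqP => // h; have := dual i i; rewrite h mul0mx eqxx.
  by rewrite eqxx.
- apply/eqP; rewrite eqEsubv subvf /=; apply/subvP => w _.
  have [k ->] := dual_span w; apply: memv_suml => i _; apply: memvZ.
  apply: (subvP (sumv_seq_sup _) _ (memv_line _)).
  by apply/family_pointsP; exists i.
Qed.

Lemma family_face i : is_equation (face family_points <[v i]>%VS) (a i).
Proof.
move=> w; apply/idP/eqP.
  apply: sumv_sub_kernel => p; rewrite in_fsetD1 => /andP[pi /family_pointsP[j hj]].
  move=> z; rewrite hj => /vlineP[k ->]; rewrite -scalemxAl.
  have /eqP -> : v j *m a i == 0; last by rewrite scaler0.
  by rewrite dual; apply: contra_neq pi => <-.
have [k ->] := dual_span w; rewrite dual_coord => /eqP.
rewrite scaler_eq0 dual eqxx orbF => /eqP ki.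
apply: memv_suml => j _; have [->|ji] := eqVneq j i.
  by rewrite ki scale0r mem0v.
apply: memvZ; apply: (subvP (sumv_seq_sup _) _ (memv_line _)).
rewrite in_fsetD1; apply/andP; split; last by apply/family_pointsP; exists j.
by apply: contra_neq ji => /family_points_inj.
Qed.

End PyramidDuality.

(** * Rational normal curves and their hyperosculating hyperplanes *)

Section Osculation.
Variables (K : closedFieldType) (n : nat).
Implicit Types (x y u w : 'rV[K]_2) (b c : 'cV[K]_n.+1).
Implicit Types (C : rnc K n) (H q : subsp K n).

(** The coefficients of the n-th power of br u x as a form in x, that is the
    hyperplane with contact of order n at u with the Veronese curve. *)
Definition osc u : 'cV[K]_n.+1 :=
  \col_(i < n.+1) ('C(n, i)%:R * ((- u 0 1) ^+ (n - i) * u 0 0 ^+ i)).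

Lemma veronese_osc u x : (veronese n x *m osc u) 0 0 = br u x ^+ n.
Proof.
have -> : br u x = - u 0 1 * x 0 0 + u 0 0 * x 0 1 by rewrite /br; ring.
rewrite exprDn mxE; apply: eq_bigr => i _; rewrite !mxE !exprMn -mulr_natl.
by ring.
Qed.

Lemma osc_scale a u : osc (a *: u) = a ^+ n *: osc u.
Proof.
apply/matrixP => i j; rewrite !mxE -mulrN !exprMn.
have im : (i <= n)%N by rewrite -ltnS.
have -> : a ^+ n = a ^+ (n - i) * a ^+ i by rewrite -exprD subnK.
by set p := a ^+ (n - i); set q := _ ^+ (n - i); ring.
Qed.

Lemma veronese_scale a x : veronese n (a *: x) = a ^+ n *: veronese n x.
Proof.
apply/rowP => i; rewrite !mxE !exprMn.
have im : (i <= n)%N by rewrite -ltnS.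
have -> : a ^+ n = a ^+ (n - i) * a ^+ i by rewrite -exprD subnK.
by set p := a ^+ (n - i); set q := _ ^+ (n - i); ring.
Qed.

Lemma form_veronese b : form n (fun x => (veronese n x *m b) 0 0).
Proof.
exists (fun i => b (inord i) 0) => x; rewrite mxE; apply: eq_bigr => i _.
by rewrite !mxE inord_val mulrC.
Qed.

Lemma veronese_inj b : (forall x, (veronese n x *m b) 0 0 = 0) -> b = 0.
Proof.
move=> h; pose p := \poly_(i < n.+1) b (inord i) 0.
have p0 : p = 0.
  apply: poly_eq_horner => z; rewrite horner0 horner_poly.
  rewrite -[RHS](h (delta_mx 0 0 + z *: delta_mx 0 1)) mxE.
  apply: eq_bigr => i _; rewrite !mxE /= inord_val.
  by rewrite mulr0 addr0 expr1n mul1r add0r mulr1 mulrC.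
apply/colP => i; have := congr1 (fun p : {poly K} => p`_i) p0.
by rewrite coef_poly ltn_ord inord_val coef0 mxE.
Qed.

Lemma form_mulmx m f (A : 'M[K]_2) : form m f -> form m (fun x => f (x *m A)).
Proof.
move=> /form_split[c [t [_ hf]]].
pose t' i : 'rV[K]_2 := \row_j (if j == 0 then t i 0 0 * A 1 1 - t i 0 1 * A 1 0
                         else t i 0 1 * A 0 0 - t i 0 0 * A 0 1).
have := form_prod_br (enum 'I_m) t' (form_const c).
rewrite size_enum_ord addn0; apply: form_ext => x.
rewrite hf mulrC big_enum; congr (_ * _); apply: eq_bigr => i _.
rewrite /br !mxE /= !big_ord_recl !big_ord0 /=.
rewrite (_ : lift _ _ = 1); last exact/val_inj.
by ring.
Qed.

(** The equation of the hyperosculating hyperplane depends on its contact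
    point through a Veronese vector as well, up to the rotation J of the
    parameter and the binomial coefficients. *)
Lemma form_osc (r : 'rV[K]_n.+1) : form n (fun u => (r *m osc u) 0 0).
Proof.
pose J : 'M[K]_2 := \matrix_(i, j) (if i == j then 0 else if i == 0 then 1 else -1).
pose d : 'cV[K]_n.+1 := \col_i (r 0 i * 'C(n, i)%:R).
apply: form_ext (form_mulmx J (form_veronese d)) => u.
rewrite !mxE; apply: eq_bigr => i _; rewrite !mxE.
rewrite !big_ord_recl !big_ord0 /= !mxE /=.
rewrite (_ : lift _ _ = 1); last exact/val_inj.
rewrite /= mulr0 mulr1 add0r addr0 addr0 mulrN1 mulr0 addr0.
by set p := _ ^+ (n - i); ring.
Qed.

(** The restriction of the linear form b to the Veronese curve, in the local
    parameter at u; its multiplicity at 0 is the vanishing order in the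
    definition of contact. *)
Definition local_poly b u : {poly K} :=
  (veronese n (local_param u) *m map_mx polyC b) 0 0.

Lemma horner_local_poly b u (z : K) : (local_poly b u).[z] =
  (veronese n (u + z *: delta_mx 0 (if u 0 0 == 0 then 0 else 1)) *m b) 0 0.
Proof.
rewrite /local_poly !mxE horner_sum; apply: eq_bigr => i _.
rewrite !mxE !hornerE_comm /= -!polyC_natr.
by rewrite !(hornerM, horner_exp, hornerD, hornerX, hornerC).
Qed.

Lemma br_local_param u : u != 0 ->
  br u (delta_mx 0 (if u 0 0 == 0 then 0 else 1)) != 0.
Proof.
move=> u0; rewrite /br; case: (eqVneq (u 0 0) 0) => h; rewrite !mxE /=.
  rewrite mulr0 sub0r mulr1 oppr_eq0.
  by apply: contra_neq u0 => h1; apply: rV2_eq; rewrite mxE.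
by rewrite mulr1 mulr0 subr0.
Qed.

(** The zero polynomial gets multiplicity 0, so contact of positive order
    excludes a hyperplane containing the curve. *)
Lemma mup0 : mup (0 : K) 0 = 0%N.
Proof.
rewrite /mup; case: arg_maxnP => [|i _ _]; first by rewrite expr0 dvd1p.
by apply/eqP; rewrite -leqn0 (leq_trans (leq_ord i)) // size_poly0.
Qed.

(** Along the local parameter z the bracket br u (u + z w) is z times the
    nonzero constant br u w. *)
Lemma mup_local_poly b u k m g : u != 0 -> form m g -> g u != 0 ->
  (forall x, (veronese n x *m b) 0 0 = br u x ^+ k * g x) ->
  mup 0 (local_poly b u) = k.
Proof.
move=> u0 hg gu hb.
pose w : 'rV[K]_2 := delta_mx 0 (if u 0 0 == 0 then 0 else 1).
have [p hp] := form_line u w hg.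
have hw : br u w != 0 := br_local_param u0.
have -> : local_poly b u = ('X - 0%:P) ^+ k * (br u w ^+ k *: p).
  apply: poly_eq_horner => z.
  rewrite horner_local_poly -/w hb hornerM horner_exp.
  by rewrite hornerXsubC hornerZ hp subr0 brDr brZr brxx add0r exprMn mulrA.
rewrite mupMl; first by rewrite mup_XsubCX eqxx.
by rewrite /root !hornerE hp scale0r addr0 mulf_neq0 ?expf_neq0.
Qed.

Lemma form_order m f u : u != 0 -> form m f -> (exists x, f x != 0) ->
  exists k l g, [/\ (k + l)%N = m, form l g, g u != 0
    & forall x, f x = br u x ^+ k * g x].
Proof.
move=> u0; elim: m f => [|m IH] f hf [x fx].
  exists 0%N, 0%N, f; split=> // [|y]; last by rewrite expr0 mul1r.
  by case: hf fx => c hc; rewrite !hc !big_ord1 !expr0.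
have [fu|fu] := eqVneq (f u) 0; last first.
  by exists 0%N, m.+1, f; split=> // y; rewrite expr0 mul1r.
have [g hg he] := form_factor u0 hf fu.
have [|k [l [h [<- hh hu heq]]]] := IH g hg.
  by exists x; apply: contra_neq fx => gx; rewrite he gx mulr0.
by exists k.+1, l, h; split=> // y; rewrite he heq exprS mulrA.
Qed.

Hypothesis n_gt0 : (0 < n)%N.

(** Proportional Veronese vectors give proportional values of every form of
    degree n; the n-th power of br x separates x from all other points. *)
Lemma rnc_point_inj C x y : x != 0 -> y != 0 ->
  rnc_point C x = rnc_point C y -> br x y = 0.
Proof.
move=> x0 y0 h; have := memv_line (veronese n y *m rnc_mx C).
rewrite -[<[_]>%VS]h => /vlineP[k].
rewrite scalemxAl => /(can_inj (mulmxK (rnc_unit C))) hk.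
have := veronese_osc x y; rewrite hk -scalemxAl mxE veronese_osc brxx.
rewrite expr0n (gtn_eqF n_gt0) mulr0 => /esym/eqP.
by rewrite expf_eq0 => /andP[_ /eqP].
Qed.

Lemma rnc_point_eq C x y : x != 0 -> y != 0 -> br x y = 0 ->
  rnc_point C x = rnc_point C y.
Proof.
move=> x0 y0 /(br_colinear x0 y0)[k k0 ->].
rewrite /rnc_point veronese_scale -scalemxAl; apply/esym/eqP.
rewrite eqEsubv -!memvE memvZ ?memv_line //=.
rewrite -{1}[_ *m _](scalerK (expf_neq0 n k0)).
by rewrite memvZ ?memv_line.
Qed.

Lemma is_equation_scale H c k : k != 0 -> is_equation H c -> is_equation H (k *: c).
Proof.
by move=> k0 h v; rewrite h -scalemxAr scaler_eq0 (negPf k0).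
Qed.

(** The equation restricts to the curve as a form of degree n vanishing to
    order n at u, that is as a constant multiple of the power br u x ^+ n; as the
    Veronese vectors span the space this fixes the equation up to a factor. *)
Lemma contactP C H q : contact C H q <->
  exists u, [/\ u != 0, q = rnc_point C u
    & is_equation H (invmx (rnc_mx C) *m osc u)].
Proof.
split=> [[u [a [u0 qu Ha]]]|[u [u0 qu Ha]]].
  rewrite /vanishing_order -/(local_poly (rnc_mx C *m a) u) => hn.
  have lp0 : local_poly (rnc_mx C *m a) u <> 0.
    by move=> h; move: hn; rewrite h mup0 => e; move: n_gt0; rewrite -e.
  have fx : exists x, (veronese n x *m (rnc_mx C *m a)) 0 0 != 0.
    apply: contrapT => h; apply: lp0; apply: poly_eq_horner => z.
    rewrite horner_local_poly horner0; apply/eqP/negPn/negP => e.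
    by apply: h; eexists; exact: e.
  have [k [l [g [kl hg gu he]]]] :=
    form_order u0 (form_veronese (rnc_mx C *m a)) fx.
  have kn : k = n by rewrite -hn (mup_local_poly u0 hg gu he).
  have l0 : l = 0%N by apply/eqP; rewrite -(eqn_add2l k) kl kn addn0.
  case: hg gu he; rewrite l0 kn => c hc; rewrite hc big_ord1 !expr0 !mulr1 => c0 he.
  have ea : rnc_mx C *m a = c 0%N *: osc u.
    apply/eqP; rewrite -subr_eq0; apply/eqP; apply: veronese_inj => y.
    rewrite mulmxBr -scalemxAr [LHS]mxE he [X in _ + X]mxE [X in _ - X]mxE.
    by rewrite veronese_osc hc big_ord1 !expr0 !mulr1 mulrC subrr.
  exists u; split=> //.
  rewrite -[osc u](scalerK c0) -ea -scalemxAr mulKmx ?rnc_unit //.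
  by apply: is_equation_scale; rewrite ?invr_eq0.
exists u, (invmx (rnc_mx C) *m osc u); split=> //.
rewrite /vanishing_order mulKVmx ?rnc_unit //.
apply: (mup_local_poly (m := 0) (g := fun=> 1) u0); first exact: form_const.
  by rewrite oner_eq0.
by move=> x; rewrite mulr1 veronese_osc.
Qed.

Lemma contact_param C H u : u != 0 -> contact C H (rnc_point C u) ->
  is_equation H (invmx (rnc_mx C) *m osc u).
Proof.
move=> u0 /contactP[y [y0 /(rnc_point_inj u0 y0) h Hy]].
have [|k k0 ->] := br_colinear y0 u0; first by rewrite brC h oppr0.
by rewrite osc_scale -scalemxAr; apply: is_equation_scale; rewrite ?expf_neq0.
Qed.

Lemma rnc_infinite C : infinite_set (rnc_points C).
Proof.
move=> /finite_seqP[ps hps].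
have /choice[U hU] p : exists u, p \in ps -> u != 0 /\ p = rnc_point C u.
  have [pp|pp] := boolP (p \in ps); last by exists 0.
  have [u u0 ->] : rnc_points C p by rewrite hps.
  by exists u.
have [|x x0 hx] := @avoid_points _ [seq U p | p <- ps].
  by move=> _ /mapP[p /hU[u0 _] ->].
have hp : rnc_point C x \in ps.
  by have : rnc_points C (rnc_point C x) by [exists x]; rewrite hps.
have [u0 /(rnc_point_inj x0 u0) h] := hU _ hp.
by have := hx _ (map_f U hp); rewrite brC h oppr0 eqxx.
Qed.

End Osculation.

(** * The incidence correspondence between the two curves *)

Section Incidence.
Variables (K : closedFieldType) (n : nat) (C1 C2 : rnc K n) (A : 'M[K]_2).
Hypothesis n_ge2 : (2 <= n)%N.
Hypothesis uA : A \in unitmx.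
Implicit Types (x y u w : 'rV[K]_2) (D : {fset subsp K n}).

Let n_gt0 : (0 < n)%N := ltnW n_ge2.

Definition vertex x : 'rV[K]_n.+1 := veronese n x *m rnc_mx C1.

(** Both curves are parametrized by the same line: the parameter y of C1 is
    matched with the parameter y *m A of C2. *)
Definition osc_plane y : 'cV[K]_n.+1 := invmx (rnc_mx C2) *m osc n (y *m A).

Definition incidence x y : K := (vertex x *m osc_plane y) 0 0.
Let E := incidence.

Lemma incidence_eq0 x y : (vertex x *m osc_plane y == 0) = (E x y == 0).
Proof.
apply/eqP/eqP => [h|h]; first by rewrite /E /incidence h [LHS]mxE.
by apply/matrixP => i j; rewrite !ord1 [RHS]mxE.
Qed.

Lemma form_incidencel y : form n (E^~ y).
Proof.
apply: form_ext (form_veronese (rnc_mx C1 *m osc_plane y)) => x.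
by rewrite mulmxA.
Qed.

Lemma form_incidencer x : form n (E x).
Proof.
apply: form_ext (form_mulmx A (form_osc (vertex x *m invmx (rnc_mx C2)))) => y.
by rewrite -mulmxA.
Qed.

Lemma inscribed_param D : inscribed D C1 -> exists s : D -> 'rV[K]_2,
  [/\ forall p, s p != 0, forall p, fsval p = rnc_point C1 (s p)
    & forall p q, p != q -> br (s p) (s q) != 0].
Proof.
move=> iD.
have /choice[s hs] (p : D) : exists x, x != 0 /\ fsval p = rnc_point C1 x.
  by have [x x0 ->] := iD _ (fsvalP p); exists x.
exists s; split=> [p|p|p q]; try by case: (hs p).
apply: contra_neq => h; apply: val_inj => /=.
by rewrite (hs p).2 (hs q).2; apply: rnc_point_eq h; [case: (hs p)|case: (hs q)].
Qed.

Lemma circumscribed_param D : circumscribed D C2 -> exists t : D -> 'rV[K]_2,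
  forall p, t p != 0 /\ is_equation (face D (fsval p)) (osc_plane (t p)).
Proof.
move=> cD; suff /choice[t ht] (p : D) : exists y : 'rV[K]_2,
    y != 0 /\ is_equation (face D (fsval p)) (osc_plane y) by exists t.
have [q /(contactP n_gt0)[u [u0 _ hu]]] := cD _ (fsvalP p).
exists (u *m invmx A); rewrite mulmx_neq0 ?unitmx_inv //.
by rewrite /osc_plane mulmxKV.
Qed.

(** The face opposite to a vertex p is osculating at t p, so E (s p) (t q) = 0
    says that the vertex p lies on the face opposite to q. *)
Lemma incidence_dual D (s t : D -> 'rV[K]_2) : pyramid D ->
  (forall p, fsval p = rnc_point C1 (s p)) ->
  (forall p, is_equation (face D (fsval p)) (osc_plane (t p))) ->
  forall p q, (E (s p) (t q) == 0) = (p != q).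
Proof.
move=> pD hs ht.
(* Both families are extended by 0 from the vertices to all subspaces. *)
pose v p := if insub p is Some p' then vertex (s p') else 0.
pose a p := if insub p is Some p' then osc_plane (t p') else 0.
have vE (p : D) : v (fsval p) = vertex (s p) by rewrite /v valK.
have aE (p : D) : a (fsval p) = osc_plane (t p) by rewrite /a valK.
have lineE p (pD' : p \in D) : p = <[v p]>%VS.
  by rewrite -[p]/(fsval [` pD']) vE {1}hs.
move=> p q; rewrite -incidence_eq0 -vE -aE (pyramid_dual (D := D)) ?fsvalP //.
by move=> r rD; rewrite -[r]/(fsval [` rD]) aE.
Qed.

(** The conjugate pyramid is the fibre from which the pencil is reconstructed. *)
Lemma conjugate_pencil D : pyramid D -> inscribed D C1 ->
  (forall x, x != 0 -> rnc_point C1 x \in D ->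
     contact C2 (face D (rnc_point C1 x)) (rnc_point C2 (x *m A))) ->
  pencil_corr n E.
Proof.
move=> pD iD hc; have [s [s0 hs sd]] := inscribed_param iD.
have cD : #|{: D}| = n.+1 by case: pD => cD _ _; rewrite -cardfE.
apply: (pencil_of_selfpolar (s := s) cD) => [|y|x].
- split=> //; apply: incidence_dual => // p.
  apply: contact_param => //; first exact: mulmx_neq0.
  by rewrite hs; apply: hc => //; rewrite -hs fsvalP.
- exact: form_incidencel.
- exact: form_incidencer.
Qed.

Hypothesis hE : pencil_corr n E.

(** Any pyramid inscribed in C1 and circumscribed about C2 is a fibre, and its
    contact points correspond to its vertices under the projectivity. The
    contact point of a face is unique since the face meets C2 nowhere else. *)
Lemma poncelet_selfpolar D : poncelet_pyramid C1 C2 D ->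
  exists s : D -> 'rV[K]_2, [/\ selfpolar E s,
    forall p, fsval p = rnc_point C1 (s p) &
    forall p q, contact C2 (face D (fsval p)) q -> q = rnc_point C2 (s p *m A)].
Proof.
case=> pD iD cD; have [s [s0 hs sd]] := inscribed_param iD.
have [t ht] := circumscribed_param cD.
have t0 p : t p != 0 by case: (ht p).
have cI : #|{: D}| = n.+1 by case: pD => h _ _; rewrite -cardfE.
have inc := incidence_dual pD hs (fun p => (ht p).2).
have [sE st] := incident_pairs_selfpolar hE n_ge2 cI s0 t0 sd inc.
exists s; split=> // p q /(contactP n_gt0)[u [u0 -> hu]].
apply: rnc_point_eq => //; first exact: mulmx_neq0.
have tu : br (t p *m A) u = 0.
  have /eqP : (veronese n u *m rnc_mx C2) *m osc_plane (t p) == 0.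
    rewrite -(ht p).2 hu mulmxA mulmxK ?rnc_unit //.
    apply/eqP/matrixP => i j; rewrite !ord1 veronese_osc brxx [RHS]mxE.
    by rewrite expr0n gtn_eqF.
  rewrite /osc_plane mulmxA mulmxK ?rnc_unit // => h.
  have := veronese_osc n (t p *m A) u; rewrite h [LHS]mxE => /esym/eqP.
  by rewrite expf_eq0 => /andP[_ /eqP].
have tsA : br (s p *m A) (t p *m A) = 0 by apply/eqP; rewrite br_mulmx_eq0 // st.
have tA0 := mulmx_neq0 uA (t0 p).
by rewrite brC (br_trans tA0 tsA tu) oppr0.
Qed.

(** The vertices of a pyramid are all the points of the fibre of any one of
    them, which is the source of both uniqueness statements. *)
Lemma poncelet_fibre D u : u != 0 -> poncelet_pyramid C1 C2 D ->
  rnc_point C1 u \in D -> forall r, r \in D <->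
  exists x, [/\ x != 0, r = rnc_point C1 x & br u x * E u x = 0].
Proof.
move=> u0 hD uD; have [s [[s0 sd sE] hs _]] := poncelet_selfpolar hD.
have cI : #|{: D}| = n.+1 by case: hD => -[h _ _] _ _; rewrite -cardfE.
pose i : D := [` uD].
have ui : br u (s i) = 0.
  by apply: (rnc_point_inj (C := C1) n_gt0 u0 (s0 i)); rewrite -hs.
move=> r; split=> [rD|[x [x0 -> hx]]].
  exists (s [` rD]); split=> //; first by rewrite -hs.
  apply: (pencil_rel_trans hE (s0 i)); first by rewrite ui mul0r.
  have [<-|ir] := eqVneq i [` rD]; first by rewrite brxx mul0r.
  by have /eqP -> : E (s i) (s [` rD]) == 0; rewrite ?sE // mulr0.
have ix : br (s i) x * E (s i) x = 0.
  by apply: (pencil_rel_trans hE u0) => //; rewrite brC ui oppr0 mul0r.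
have [k hk] := selfpolar_fibre hE cI (And3 s0 sd sE) x0 ix.
by rewrite -(rnc_point_eq C1 (s0 k) x0 hk) -hs fsvalP.
Qed.

Lemma poncelet_unique D D' p : rnc_points C1 p ->
  poncelet_pyramid C1 C2 D -> p \in D ->
  poncelet_pyramid C1 C2 D' -> p \in D' -> D = D'.
Proof.
case=> u u0 -> hD uD hD' uD'; apply/fsetP => r; apply/idP/idP.
  by move/(poncelet_fibre u0 hD uD)/(poncelet_fibre u0 hD' uD').
by move/(poncelet_fibre u0 hD' uD')/(poncelet_fibre u0 hD uD).
Qed.

Lemma vertex_of_contact D y : y != 0 -> poncelet_pyramid C1 C2 D ->
  contact_of_face C2 D (rnc_point C2 (y *m A)) -> rnc_point C1 y \in D.
Proof.
move=> y0 hD [p pD hc]; have [s [[s0 _ _] hs hq]] := poncelet_selfpolar hD.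
have := hq [` pD] _ hc => /(rnc_point_inj n_gt0).
move=> /(_ (mulmx_neq0 uA y0) (mulmx_neq0 uA (s0 _)))/eqP.
rewrite br_mulmx_eq0 // => /eqP h.
by rewrite (rnc_point_eq C1 y0 (s0 _) h) -hs.
Qed.

(** In a fibre without repeated points, the points of C1 and the hyperplanes
    hyperosculating C2 at the corresponding points are dual to each other. *)
Lemma poncelet_exists : exists2 bad : seq 'rV[K]_2,
  (forall b, b \in bad -> b != 0) &
  forall x, x != 0 -> (forall b, b \in bad -> br b x != 0) ->
  exists D, [/\ poncelet_pyramid C1 C2 D, rnc_point C1 x \in D &
     contact_of_face C2 D (rnc_point C2 (x *m A))].
Proof.
have [bad bad0 hb] := pencil_generic_fibre hE.
exists bad => // x x0 /(hb x x0)[s sx [s0 sd sE]].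
have cI : #|{: option 'I_n}| = n.+1 by rewrite card_option card_ord.
have dual i j : (vertex (s i) *m osc_plane (s j) == 0) = (i != j).
  by rewrite incidence_eq0 sE.
pose D := family_points (vertex \o s).
have mD i : rnc_point C1 (s i) \in D by apply/family_pointsP; exists i.
have hc i : contact C2 (face D (rnc_point C1 (s i))) (rnc_point C2 (s i *m A)).
  apply/(contactP n_gt0); exists (s i *m A); split=> //; first exact: mulmx_neq0.
  exact: (family_face (v := vertex \o s) (a := osc_plane \o s) cI dual i).
exists D; split; last 2 first.
- by rewrite -sx.
- by rewrite -sx; exists (rnc_point C1 (s None)); [exact: mD|exact: hc].
split.
- exact: (family_pyramid (v := vertex \o s) (a := osc_plane \o s) cI dual).
- by move=> p /family_pointsP[i ->]; exists (s i).
- by move=> p /family_pointsP[i ->]; exists (rnc_point C2 (s i *m A)); exact: hc.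
Qed.

End Incidence.

(** * The porism *)

Local Open Scope fset_scope.
Local Open Scope classical_set_scope.

Theorem theorem1 (K : closedFieldType) (n : nat) (C1 C2 : rnc K n)
    (D : {fset subsp K n}) :
  (2 <= n)%N ->
  pyramid D -> inscribed D C1 -> circumscribed D C2 -> conjugate D C1 C2 ->
  [/\ infinite_set [set D' | poncelet_pyramid C1 C2 D'],
      (* each point of C1 is a vertex of at most one such pyramid, and of
         exactly one apart from finitely many points *)
      (forall p, rnc_points C1 p -> forall D' D'',
         poncelet_pyramid C1 C2 D' -> p \in D' ->
         poncelet_pyramid C1 C2 D'' -> p \in D'' -> D' = D'')
      /\ finite_set [set p | rnc_points C1 p /\
           ~ exists D', poncelet_pyramid C1 C2 D' /\ p \in D']
    & (* each point of C2 is the contact point of a face of at most one such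
         pyramid, and of exactly one apart from finitely many points *)
      (forall q, rnc_points C2 q -> forall D' D'',
         poncelet_pyramid C1 C2 D' -> contact_of_face C2 D' q ->
         poncelet_pyramid C1 C2 D'' -> contact_of_face C2 D'' q -> D' = D'')
      /\ finite_set [set q | rnc_points C2 q /\
           ~ exists D', poncelet_pyramid C1 C2 D' /\ contact_of_face C2 D' q]].
Proof.
move=> n2 pD iD cD [f [A uA hf] hconj].
have hE : pencil_corr n (incidence C1 C2 A).
  apply: (conjugate_pencil n2 uA pD iD) => x x0 xD.
  by rewrite -hf //; exact: hconj.
have [bad bad0 hbad] := poncelet_exists n2 uA hE.
have exc x : x != 0 -> ~ (exists D', [/\ poncelet_pyramid C1 C2 D',
    rnc_point C1 x \in D' & contact_of_face C2 D' (rnc_point C2 (x *m A)%R)]) ->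
    exists2 b, b \in bad & br b x = 0%R.
  move=> x0 h; apply: contrapT => nb; apply: h; apply: hbad => // b bb.
  by apply/eqP => h; apply: nb; exists b.
have fin1 : finite_set [set p | rnc_points C1 p /\
    ~ exists D', poncelet_pyramid C1 C2 D' /\ p \in D'].
  apply: (@sub_finite_set _ _ [set` [seq rnc_point C1 b | b <- bad]]);
    last by apply/finite_seqP; eexists.
  move=> p [[x x0 ->] hp]; have [|b bb bx] := exc x x0.
    by case=> D' [h1 h2 _]; apply: hp; exists D'.
  by apply/mapP; exists b => //; rewrite (rnc_point_eq C1 (bad0 _ bb) x0 bx).
have par2 q : rnc_points C2 q -> exists2 y, y != 0%R & q = rnc_point C2 (y *m A)%R.
  case=> u u0 ->; exists (u *m invmx A)%R; last by rewrite mulmxKV.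
  by rewrite mulmx_neq0 ?unitmx_inv.
split.
- (* C1 consists of the exceptional points and of the vertices of the
     pyramids, and each pyramid has finitely many vertices. *)
  move=> finD; apply: (rnc_infinite (ltnW n2) (C := C1)).
  apply: (@sub_finite_set _ _ ([set p | rnc_points C1 p /\
    ~ exists D', poncelet_pyramid C1 C2 D' /\ p \in D'] `|`
    \bigcup_(D' in [set D' | poncelet_pyramid C1 C2 D']) [set` D'])).
    move=> p hp.
    have [[D' [h1 h2]]|h] :=
      pselect (exists D', poncelet_pyramid C1 C2 D' /\ p \in D').
      by right; exists D'.
    by left.
  rewrite finite_setU; split=> //.
  by apply: bigcup_finite => // D' _; exact: finite_fset.
- by split=> // p hp D' D''; exact: (poncelet_unique n2 uA hE hp).
- split.
    move=> q /par2[y y0 ->] D' D'' h1 c1 h2 c2.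
    apply: (poncelet_unique n2 uA hE (p := rnc_point C1 y)) => //.
    + by exists y.
    + exact: (vertex_of_contact n2 uA hE).
    + exact: (vertex_of_contact n2 uA hE).
  apply: (@sub_finite_set _ _ [set` [seq rnc_point C2 (b *m A)%R | b <- bad]]);
    last by apply/finite_seqP; eexists.
  move=> q [/par2[y y0 ->] hq]; have [|b bb bx] := exc y y0.
    by case=> D' [h1 _ h2]; apply: hq; exists D'.
  apply/mapP; exists b => //; apply/esym; apply: rnc_point_eq.
  + by rewrite mulmx_neq0 // bad0.
  + exact: mulmx_neq0.
  + by apply/eqP; rewrite br_mulmx_eq0 // bx.
Qed.
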